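(* Let $T$ be a tree with bipartition $\{A,B\}$. If $S$ is a stable set of $T$ such that $|S|>\min\{|A|,|B|\}$, then $S\cap pend(T)\neq\varnothing$. Moreover, there exist $v\in S\cap pend(T)$ and $w\in S$ such that the distance between $v$ and $w$ in $T$ is $2$.
   Context: All graphs are finite, simple and undirected. A tree is a connected acyclic graph of order (number of vertices) greater than one. A set of vertices is stable if no two of its vertices are adjacent. The bipartition $\{A,B\}$ of a tree $T$ is the (unique) partition of its vertex set into two stable sets $A$ and $B$. A vertex $v$ of a graph $G$ is pendant if it has exactly one neighbor in $G$, and $pend(G)$ denotes the set of all pendant vertices of $G$. *)

(* Defs.v *)
From mathcomp Require Import all_boot.

Set Implicit Arguments.
Unset Strict Implicit.
Unset Printing Implicit Defensive.

(* MathComp development: finite simple undirected graphs over a finType. *)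

Record sgraph := SGraph {
  vertex :> finType;
  adj : rel vertex;
  adj_sym : symmetric adj;
  adj_irrefl : irreflexive adj }.

Section Graph.
Variable G : sgraph.
Implicit Types (x y : G) (A B S : {set G}).

Definition connected : Prop := forall x y, connect (@adj G) x y.

(* A cycle is given by its list of distinct vertices; the size bound rules out
   the degenerate case [:: x; y], which traverses a single edge twice. *)
Definition acyclic : Prop :=
  forall c : seq G, 2 < size c -> ~ ucycle (@adj G) c.

Definition tree : Prop := [/\ connected, acyclic & 1 < #|G|].

Definition stable S : Prop := {in S &, forall x y, ~~ adj x y}.

Definition bipartition A B : Prop :=
  [/\ A != B, partition [set A; B] [set: G], stable A & stable B].

Definition neighbors x : {set G} := [set y | adj x y].

Definition pend : {set G} := [set x | #|neighbors x| == 1].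

(* The distance is a relation, so that it needs no default value for vertices
   in different components.  The vertex list p excludes the start point x,
   so size p is the number of edges. *)
Definition walk x y (p : seq G) : bool := path (@adj G) x p && (last x p == y).

Definition dist_is x y (n : nat) : Prop :=
  (exists2 p, walk x y p & size p = n) /\ (forall p, walk x y p -> n <= size p).

End Graph.

Arguments pend G : clear implicits.

(* Main.v *)
Require Import Defs.
From mathcomp Require Import all_boot.

Set Implicit Arguments.
Unset Strict Implicit.
Unset Printing Implicit Defensive.

(** Let [A] be the smaller side.  Cancelling [S :&: A] from both sides of
    [#|A| < #|S|] leaves [#|A :\: S| < #|S :&: B|], and all the neighbors of a
    vertex of [S :&: B] lie in [A :\: S].  So any map [f] that sends each
    vertex to one of its neighbors makes two vertices [x1 != x2] of [S :&: B]
    collide; having a common neighbor, they are at distance 2.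

    It remains to choose [f] so that one of [x1], [x2] must be pendant.  Root
    the tree at any vertex [r].  A vertex that is not pendant has two neighbors,
    of which at most one is its parent, so [f] can send it to a child
    ([pendant_or_child]).  Two vertices that are both sent to a child cannot
    collide, as a vertex has only one parent ([parent_unique]). *)

Section Acyclic.
Variable G : sgraph.
Implicit Types (x y z r : G) (p : seq G).

(** Otherwise a simple path extracted from [p] would close up into a cycle
    through [y]. *)
Lemma acyclic_detour y x p : acyclic G ->
  path (@adj G) x p -> y \notin x :: p -> adj y x -> adj y (last x p) ->
  last x p = x.
Proof.
move=> acyG pathp; case/shortenP: pathp => p' pathp' uniq_p' sub_p' y'p yx.
case: p' => [|z p'] // in pathp' uniq_p' sub_p' * => ylast.
case: (acyG [:: y, x, z & p']) => //; rewrite /ucycle; apply/andP; split.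
  by move: pathp' ylast; rewrite /= rcons_path yx (adj_sym _ y) => /andP[-> ->] ->.
rewrite cons_uniq uniq_p' andbT; apply: contra y'p.
by case/predU1P=> [->|/sub_p' yp]; rewrite in_cons ?eqxx ?yp ?orbT.
Qed.

Definition adj_avoiding y u v := [&& adj u v, u != y & v != y].

(** Deleting a vertex [y != r] of a tree leaves one component for each neighbor
    of [y], and the parent of [y] is the neighbor in the component of the root
    [r].  This describes the rooted tree without measuring distances. *)
Definition parent r x y := adj x y && connect (adj_avoiding y) x r.

Lemma path_avoiding y x p :
  y != x -> path (adj_avoiding y) x p = path (@adj G) x p && (y \notin p).
Proof.
elim: p x => [|z p IHp] x yx //=; rewrite inE negb_or {1}/adj_avoiding (eq_sym x) yx /=.
rewrite (eq_sym z); case: (eqVneq y z) => [|yz] /=; first by rewrite !andbF.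
by rewrite IHp // andbT andbA.
Qed.

Lemma parent_unique r y x1 x2 :
  acyclic G -> parent r x1 y -> parent r x2 y -> x1 = x2.
Proof.
move=> acyG /andP[x1y x1r] /andP[x2y x2r].
have sym : connect_sym (adj_avoiding y).
  by apply: sym_connect_sym => u v; rewrite /adj_avoiding adj_sym andbCA andbC andbA.
have yx1 : y != x1 by apply: contraTneq x1y => ->; rewrite adj_irrefl.
rewrite sym in x2r; case/connectP: (connect_trans x1r x2r) => p.
rewrite path_avoiding // => /andP[pathp y'p] x2E.
rewrite x2E; apply/esym/(@acyclic_detour y) => //.
- by rewrite inE negb_or yx1.
- by rewrite adj_sym.
by rewrite -x2E adj_sym.
Qed.

Lemma tree_neighbor x : tree G -> exists y, adj x y.
Proof.
case=> connG _ /card_gt1P[a [b [_ _ ab]]].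
have [z xz] : exists z, z != x.
  by case: (eqVneq a x) ab => [-> xb|ax _]; [exists b; rewrite eq_sym|exists a].
case/connectP: (connG x z) xz => [[_ ->|y p /andP[xy _] _ _]].
  by rewrite eqxx.
by exists y.
Qed.

(** Any neighbor [y] of [x] off the simple path from [x] to the root [r] has [x]
    as its parent, and that path meets the neighbors of [x] only in its first
    step, since a later one would give a cycle through [x]. *)
Lemma pendant_or_child r x : tree G ->
  exists y, adj x y /\ (x \in pend G \/ parent r x y).
Proof.
move=> treeG; have [y0 xy0] := tree_neighbor x treeG.
have [xpend|x'pend] := boolP (x \in pend G); first by exists y0; split; [|left].
have [connG acyG _] := treeG.
case/connectP: (connG x r) => p0 pathp0 rE.
case/shortenP: pathp0 rE => p pathp uniq_p _ rE.
(* The head of [p] is the next vertex on the way to the root; at [x = r] the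
   default [x] excludes no neighbor. *)
have [y xy y'head] : exists2 y, adj x y & y != head x p.
  have [/exists_inP[y]|no_y] :=
    boolP [exists (y | adj x y), y != head x p]; first by exists y.
  have allhead y : adj x y -> y = head x p.
    move=> xy; apply/eqP; apply: contraNT no_y => y'h.
    by apply/exists_inP; exists y.
  case/negP: x'pend; rewrite inE; apply/cards1P; exists y0; apply/setP=> y.
  rewrite !inE; apply/idP/eqP => [xy|-> //].
  by rewrite (allhead y xy) (allhead y0 xy0).
exists y; split=> //; right; rewrite /parent xy; apply/connectP; exists p => //.
have yx : y != x by apply: contraTneq xy => ->; rewrite adj_irrefl.
rewrite path_avoiding // pathp /=.
case: p => [|z p] //= in pathp uniq_p y'head rE *.
rewrite inE negb_or y'head /=; apply/negP=> yp.
(* A path from [z] to [y] that avoids their common neighbor [x]. *)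
case/splitPr: yp pathp uniq_p {rE} => p1 p2.
rewrite -cat_rcons cat_path => /and3P[xz pathzy _] /and3P[xzp _ _].
move: xzp; rewrite inE mem_cat !negb_or => /and3P[xz' xp1 _].
case/eqP: y'head; have := @acyclic_detour x z (rcons p1 y) acyG pathzy.
rewrite last_rcons; apply=> //.
by rewrite inE negb_or xz'.
Qed.

Lemma dist2_common_neighbor x y z :
  adj x y -> adj z y -> x != z -> ~~ adj x z -> dist_is x z 2.
Proof.
move=> xy zy xz xz'; split.
  by exists [:: y; z] => //; rewrite /walk /= xy adj_sym zy eqxx.
case=> [|u [|v p]] //; rewrite /walk /=; first by rewrite (negbTE xz).
by rewrite andbT => /andP[xu /eqP uz]; rewrite -uz xu in xz'.
Qed.

End Acyclic.

Lemma bipartitionC (G : sgraph) (A B : {set G}) :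
  bipartition A B -> bipartition B A.
Proof. by case=> AB part stA stB; split; rewrite 1?eq_sym 1?setUC. Qed.

Lemma bipartition_notin (G : sgraph) (A B : {set G}) x :
  bipartition A B -> x \notin B -> x \in A.
Proof.
case=> AB /and3P[/eqP covAB _ _] _ _ /negbTE xB; have := in_setT x.
by rewrite -covAB /cover bigcup_setU !big_set1 inE xB orbF.
Qed.

(** Pigeonhole: [f] maps [S :&: B] into the smaller set [A :\: S], because
    neither [B] nor [S] contains both ends of an edge. *)
Lemma stable_collision (T : sgraph) (A B S : {set T}) (f : T -> T) :
  bipartition A B -> stable S -> #|A| < #|S| -> (forall x, adj x (f x)) ->
  exists x1 x2, [/\ x1 \in S, x2 \in S, x1 != x2 & f x1 = f x2].
Proof.
move=> bipAB stS ltAS adjf; have [_ _ _ stB] := bipAB.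
have ltX : #|A :\: S| < #|S :&: B|.
  have SsubAB : S :\: A \subset S :&: B.
    apply/subsetP=> x; rewrite !inE => /andP[xA ->].
    exact: bipartition_notin (bipartitionC bipAB) xA.
  apply: leq_trans (subset_leq_card SsubAB).
  by rewrite -(ltn_add2l #|A :&: S|) cardsID setIC cardsID.
have fX : f @: (S :&: B) \subset A :\: S.
  apply/subsetP=> _ /imsetP[x /setIP[xS xB] ->]; rewrite inE.
  apply/andP; split; first by apply: contraL (adjf x) => /(stS _ _ xS).
  apply: (bipartition_notin bipAB).
  by apply: contraL (adjf x) => /(stB _ _ xB).
have /dinjectivePn[x1 x1X [x2 /andP[/= x21 x2X] fE]] :
    ~~ dinjectiveb f (mem (S :&: B)).
  apply: contraL ltX => /dinjectiveP injf.
  by rewrite -leqNgt -(card_in_imset injf) subset_leq_card.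
exists x1, x2; split=> //; last by rewrite eq_sym.
  by case/setIP: x1X.
by case/setIP: x2X.
Qed.

Theorem theorem2p6 (T : sgraph) (A B S : {set T}) :
  tree T -> bipartition A B -> stable S -> minn #|A| #|B| < #|S| ->
  S :&: pend T != set0 /\
  (exists v w : T, [/\ v \in S :&: pend T, w \in S & dist_is v w 2]).
Proof.
move=> treeT bipAB stS ltS.
suff exvw : exists v w : T, [/\ v \in S :&: pend T, w \in S & dist_is v w 2].
  by split=> //; case: exvw => v [w [vSp _ _]]; apply/set0Pn; exists v.
wlog ltA : A B bipAB ltS / #|A| < #|S|.
  move=> IH; have:= ltS; rewrite gtn_min => /orP[|ltB]; first exact: IH bipAB _.
  by apply: (IH B A) => //; [exact: bipartitionC | rewrite minnC].
have [_ acyT /ltnW/card_gt0P[r _]] := treeT.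
have [f fP] := fin_all_exists (fun x => pendant_or_child r x treeT).
have [x1 [x2 [x1S x2S x12 fE]]] :=
  stable_collision bipAB stS ltA (fun x => (fP x).1).
have [adj1 pc1] := fP x1; have [adj2 pc2] := fP x2.
rewrite fE in adj1 pc1.
have d12 := dist2_common_neighbor adj1 adj2 x12 (stS _ _ x1S x2S).
case: pc1 => [p1|par1]; first by exists x1, x2; rewrite inE x1S p1.
case: pc2 => [p2|par2].
  exists x2, x1; rewrite inE x2S p2; split=> //.
  by apply: dist2_common_neighbor adj2 adj1 _ (stS _ _ x2S x1S); rewrite eq_sym.
by case/eqP: x12; apply: parent_unique acyT par1 par2.
Qed.
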